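(* Let $a,b$ be integers with $1\leq a\leq b$, let $K_{a,b}$ be the complete bipartite graph with parts of sizes $a$ and $b$, and let $k$ be an integer with $2\leq k\leq a+b$. Then the $k$-path-connectivity $\pi_k(K_{a,b})$ is given as follows. (1) If $2\leq k\leq a$, then $\pi_k(K_{a,b})=\left\lfloor\frac{a}{k-1}\right\rfloor$. (2) Otherwise (that is, if $a+1\leq k\leq a+b$): (i) if $a=b$, then $$\pi_k(K_{a,b})=\begin{cases}1, & \text{if } a=3 \text{ and } k=4,\ \text{ or } a\geq 4 \text{ and } a+1\leq k\leq 2a-3,\\ 2, & \text{if } a\geq 4 \text{ and } k=2a-2,\\ \max\{\lfloor\frac{a}{2}\rfloor,1\}, & \text{if } a\geq 2 \text{ and } k=2a-1,\ \text{ or } a\geq 1 \text{ and } k=2a;\end{cases}$$ (ii) if $b=a+1$ (with $a\geq 1$), then $$\pi_k(K_{a,b})=\begin{cases}1, & \text{if } a+1\leq k\leq 2a,\\ \lfloor\frac{a+1}{2}\rfloor, & \text{if } k=2a+1=a+b;\end{cases}$$ (iii) if $b\geq a+2$ (with $a\geq 1$), then $$\pi_k(K_{a,b})=\begin{cases}1, & \text{if } k=a+1,\\ 0, & \text{if } a+2\leq k\leq a+b.\end{cases}$$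
   Context: All graphs are finite and simple. For a graph $G=(V,E)$ and a set $S\subseteq V(G)$ of size at least $2$, a path in $G$ is called an $S$-path if it connects all vertices of $S$, i.e. it contains every vertex of $S$ (it may contain other vertices as well). Two $S$-paths $P_1$ and $P_2$ are internally disjoint if $E(P_1)\cap E(P_2)=\emptyset$ and $V(P_1)\cap V(P_2)=S$. Let $\pi_G(S)$ denote the maximum number of (pairwise) internally disjoint $S$-paths in $G$. For a graph $G$ with $n$ vertices and $2\leq k\leq n$, the $k$-path-connectivity of $G$ is $\pi_k(G)=\min\{\pi_G(S) : S\subseteq V(G),\ |S|=k\}$. *)

(* Defs.v *)
From mathcomp Require Import all_boot.

Set Implicit Arguments.
Unset Strict Implicit.
Unset Printing Implicit Defensive.

Record sgraph := SGraph {
  vertex :> finType;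
  edge : rel vertex;
  edge_sym : symmetric edge;
  edge_irrefl : irreflexive edge }.

Section PathConnectivity.

Variable G : sgraph.

(* The path v_0 v_1 ... v_m is given as the vertex sequence
   [:: v_0; v_1; ...; v_m]. *)
Definition is_gpath (p : seq G) : bool :=
  [&& p != [::], sorted (@edge G) p & uniq p].

(* A duplicate-free sequence has at most #|G| items, so the bound on the length
   is no restriction; it only makes the type of all paths of G a finType. *)
Definition gpath := {p : {bseq #|G| of G} | is_gpath p}.

Definition pvertices (p : gpath) : {set G} := [set x | x \in val p].

Definition pedges (p : gpath) : {set {set G}} :=
  [set:: [seq [set xy.1; xy.2] | xy <- zip (val p) (behead (val p))]].

Definition is_Spath (S : {set G}) (p : gpath) : bool := S \subset pvertices p.

Definition internally_disjoint (S : {set G}) (p q : gpath) : bool :=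
  (pedges p :&: pedges q == set0) && (pvertices p :&: pvertices q == S).

(* The two orientations of a path are different elements of gpath. When
   #|S| >= 2 every S-path has an edge, so they are not internally disjoint and
   a family F contains at most one of them. *)
Definition disjoint_Spaths (S : {set G}) (F : {set gpath}) : bool :=
  [forall p in F, is_Spath S p] &&
  [forall p in F, forall q in F, (p != q) ==> internally_disjoint S p q].

Definition pi_set (S : {set G}) : nat :=
  \max_(F : {set gpath} | disjoint_Spaths S F) #|F|.

(* The starting value of the minimum is an upper bound of its terms, so that it
   does not affect the result when k <= #|G|; see kpath_connectivityP. *)
Definition kpath_connectivity (k : nat) : nat :=
  \big[minn / \max_(S : {set G} | #|S| == k) pi_set S]_(S : {set G} | #|S| == k)
    pi_set S.

Lemma kpath_connectivityP k : k <= #|G| ->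
  (exists2 S : {set G}, #|S| = k & pi_set S = kpath_connectivity k) /\
  (forall S : {set G}, #|S| = k -> kpath_connectivity k <= pi_set S).
Proof.
move=> le_kG; set m := \max_(S : {set G} | #|S| == k) pi_set S.
have min_le (S : {set G}) : #|S| = k -> kpath_connectivity k <= pi_set S.
  move=> /eqP Sk; rewrite /kpath_connectivity -/m.
  elim: (index_enum _) (mem_index_enum S) => // T r IH; rewrite inE big_cons.
  case/predU1P=> [<-|/IH le_r]; first by rewrite Sk geq_minl.
  by case: ifP => // _; apply: leq_trans (geq_minr _ _) le_r.
split=> //.
have [S0 S0k] : exists S : {set G}, #|S| == k.
  exists [set:: take k (enum G)]; rewrite cardsE; apply/eqP.
  have /card_uniqP -> := take_uniq k (enum_uniq G).
  by rewrite size_takel // -cardE.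
have [S [/eqP Sk Sm]] : exists S : {set G}, #|S| == k /\ pi_set S = m.
  have [|S SP Sm] := @eq_bigmax_cond _ [pred S : {set G} | #|S| == k] pi_set.
    by apply/card_gt0P; exists S0.
  by exists S; split=> //; rewrite -Sm.
have : kpath_connectivity k = m \/
       exists2 S : {set G}, #|S| = k & pi_set S = kpath_connectivity k.
  rewrite /kpath_connectivity -/m.
  elim/big_ind: _ => [|x y Hx Hy|U /eqP Uk]; first by left.
  - by rewrite /minn; case: ifP.
  - by right; exists U.
by case=> [->|//]; exists S.
Qed.

End PathConnectivity.

Section CompleteBipartite.

Variables a b : nat.

Definition Kbip_edge : rel ('I_a + 'I_b)%type :=
  fun x y => is_inl x != is_inl y.

Lemma Kbip_edge_sym : symmetric Kbip_edge.
Proof. by move=> x y; rewrite /Kbip_edge eq_sym. Qed.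

Lemma Kbip_edge_irrefl : irreflexive Kbip_edge.
Proof. by move=> x; rewrite /Kbip_edge eqxx. Qed.

Definition Kbip : sgraph := SGraph Kbip_edge_sym Kbip_edge_irrefl.

End CompleteBipartite.

(* Main.v *)
Require Import Defs.
From mathcomp Require Import all_boot zify.

(** Let [A] and [B] be the sides, of sizes [a <= b], and let [S] have [x]
    vertices in [A] and [y] in [B], with [x + y = k].

    All upper bounds come from two counts over a family [F] of internally
    disjoint [S]-paths.

    A path alternates between the sides, so its vertex numbers on the two sides
    differ by at most one. An [S]-path therefore needs at least [y - 1 - x]
    vertices of [A] outside [S], and these are private to it:
    [#|F| * (y - 1 - x) <= a - x] ([disjoint_Spaths_side_bound]). With [y] as
    large as possible this settles all cases but those of the next count.

    A vertex of a path outside [S] accounts for at most two of its edges, so an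
    [S]-path with [q] vertices outside [S] has at least [k - 1 - q] edges inside
    [S]. These edges and these outer vertices are again private:
    [#|F| * (k - 1) <= x * y + (a + b - k)] ([disjoint_Spaths_edge_bound]). This
    handles [k = 2a - 1] and [k = 2a] for [a = b], [k = 2a + 1] for [b = a + 1],
    and the exception [a = b = 3], [k = 4].

    For the lower bounds every path is a zigzag: a list of vertices of one side
    interleaved with a list of vertices of the other. An edge of a zigzag joins
    vertices whose positions in the two lists are equal or consecutive
    ([zigzag_edge]), and all disjointness of edges follows from this.

    - For [k <= a] each path gets private vertices outside [S], enough to
      separate the vertices of [S] from each other; only one path is allowed an
      edge inside [S], which saves the one vertex per side that would otherwise
      be missing ([pi_set_chunks]).

    - When [S] contains a side and as many vertices of the other, or one less,
      the list of the first side is rotated by 0, 2, 4, ...: the edges of the path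
      rotated by [2j] have position difference [2j] or [2j + 1] modulo the size
      of the side, so the paths are edge-disjoint ([pi_set_rotations]). They are
      parts of the classical disjoint Hamiltonian cycles of [K_{n,n}].

    - For [a = b] and [k = 2a - 2] the rotations by 0 and 2 are combined with
      the two vertices missed by [S], placed at a common position of the list or
      used by one path only ([pi_set_ge2_full_side], [pi_set_ge2_balanced]).

    - One path exists as soon as [y <= a + 1] ([pi_set_ge1]). *)

Set Implicit Arguments.
Unset Strict Implicit.
Unset Printing Implicit Defensive.

(** * Edges of vertex sequences and zigzags *)

Section SeqEdges.

Variable T : finType.
Implicit Types (p s t : seq T) (S : {set T}) (E : {set T}).

Definition seq_edges p : seq {set T} :=
  [seq [set xy.1; xy.2] | xy <- zip p (behead p)].

Lemma seq_edges_cons x y p :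
  seq_edges [:: x, y & p] = [set x; y] :: seq_edges (y :: p).
Proof. by []. Qed.

Lemma seq_edges_sub E p : E \in seq_edges p -> E \subset [set:: p].
Proof.
elim: p => [|x [|y p] IH] //; rewrite seq_edges_cons inE => /predU1P[-> | /IH].
  by apply/subsetP=> z; rewrite !inE => /orP[] /eqP->; rewrite eqxx ?orbT.
move=> sEp; apply: (subset_trans sEp); apply/subsetP=> z.
by rewrite !inE => ->; rewrite orbT.
Qed.

Lemma seq_edges_uniq p : uniq p -> uniq (seq_edges p).
Proof.
elim: p => [|x [|y p] IH] // /andP[x_notin /IH uniqE].
rewrite seq_edges_cons [uniq _]/= uniqE andbT.
apply: contra x_notin => /seq_edges_sub /subsetP/(_ x).
by rewrite !inE eqxx => ->.
Qed.

Lemma seq_edges_neq0 p : 1 < size p -> exists E, E \in seq_edges p.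
Proof. by case: p => [|x [|y p]] // _; exists [set x; y]; rewrite inE eqxx. Qed.

(** Each item outside [S] destroys at most two of the consecutive pairs, hence
    splits the items of [S] into at most one more run. The induction needs the
    sharper form in which the 1 is dropped when the head is outside [S]. *)
Lemma count_seq_edges S p :
  count (mem S) p <=
    count (fun E => E \subset S) (seq_edges p) + count (predC (mem S)) p + 1.
Proof.
suff: count (mem S) p <= count (fun E => E \subset S) (seq_edges p)
          + count (predC (mem S)) p + (head false [seq x \in S | x <- p]).
  by case: (head _ _) => /=; lia.
elim: p => [|x [|y p] IH] //; first by rewrite /=; case: (x \in S).
move: IH; rewrite seq_edges_cons; set es := seq_edges _.
rewrite /= subUset !sub1set.
by case: (x \in S); case: (y \in S) => /=; lia.
Qed.

(** Meant for [size t <= size s <= (size t).+1]; longer lists are truncated. *)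
Fixpoint zigzag s t : seq T :=
  match s, t with
  | x :: s', y :: t' => x :: y :: zigzag s' t'
  | x :: _, [::] => [:: x]
  | [::], _ => [::]
  end.

Lemma perm_zigzag s t : size t <= size s <= (size t).+1 ->
  perm_eq (zigzag s t) (s ++ t).
Proof.
elim: s t => [|x s IH] [|y t] //=; first by case: s {IH}.
rewrite !ltnS => /IH perm_st; rewrite perm_cons perm_sym.
by rewrite -[y :: t]cat1s perm_catCA /= perm_cons perm_sym.
Qed.

Lemma sorted_zigzag (e : rel T) (P Q : {pred T}) s t :
    (forall x y, x \in P -> y \in Q -> e x y && e y x) ->
    {subset s <= P} -> {subset t <= Q} ->
  sorted e (zigzag s t).
Proof.
move=> ePQ; elim: s t => [|x s IH] [|y t] //= sP tQ.
have [xP yQ] : x \in P /\ y \in Q.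
  by split; [apply: sP | apply: tQ]; rewrite inE eqxx.
have sP' : {subset s <= P} by move=> z zs; apply: sP; rewrite inE zs orbT.
have tQ' : {subset t <= Q} by move=> z zt; apply: tQ; rewrite inE zt orbT.
have [exy _] := andP (ePQ x y xP yQ); rewrite exy /=.
move: (IH t sP' tQ'); case: s {IH sP} sP' => [|x' s] //= sP'.
have x'P : x' \in P by apply: sP'; rewrite inE eqxx.
have [_ eyx'] := andP (ePQ x' y x'P yQ).
by case: t {tQ tQ'} => [|y' t] /=; rewrite eyx'.
Qed.

(** Every argument for edge-disjointness reduces to this: an edge determines,
    up to one unit, the offset between the positions of its ends. *)
Lemma zigzag_edge s t E : uniq s -> uniq t -> E \in seq_edges (zigzag s t) ->
  exists u v, [/\ E = [set u; v], u \in s, v \in t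
    & index v t <= index u s <= (index v t).+1].
Proof.
elim: s t => [|x s IH] [|y t] //= /andP[xs us] /andP[yt ut].
rewrite seq_edges_cons inE => /predU1P[-> | ].
  by exists x, y; rewrite !inE !eqxx.
case: s => [|x' s] // in IH us xs *.
have -> : seq_edges (y :: zigzag (x' :: s) t) =
          [set y; x'] :: seq_edges (zigzag (x' :: s) t) by case: (t).
rewrite inE => /predU1P[-> | /(IH t us ut) [u [v [-> us' vt le_uv]]]].
  exists x', y; rewrite setUC !inE !eqxx orbT; split=> //.
  by case: eqP xs => [->|_]; rewrite ?inE ?eqxx //= eqxx.
exists u, v; split=> //; [by rewrite in_cons us' orbT | by rewrite in_cons vt orbT|].
have [x_u y_v]: x != u /\ y != v.
  by split; [apply: contraNneq xs | apply: contraNneq yt] => ->.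
by move: le_uv; rewrite /= (negPf x_u) (negPf y_v) !ltnS.
Qed.

Lemma index_rot s q v : uniq s -> q < size s -> v \in s ->
  index v s = (index v (rot q s) + q) %% size s.
Proof.
move=> us qs vs; rewrite -{1}(cat_take_drop q s) index_cat.
have := cat_take_drop q s; set s1 := take q s; set s2 := drop q s => def_s.
have s1q : size s1 = q by rewrite size_take qs.
have s2q : size s2 = size s - q by rewrite size_drop.
have [vs1 | vs1] := boolP (v \in s1).
  have vs2 : v \notin s2.
    by move: us; rewrite -def_s cat_uniq => /and3P[_ /hasPn/(_ v)/contraL->].
  have lt_v : index v s1 < q by rewrite -s1q index_mem.
  rewrite /rot -/s1 -/s2 index_cat (negPf vs2) s2q.
  by rewrite addnAC subnK 1?ltnW // addnC modnDr modn_small //; lia.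
have vs2 : v \in s2 by move: vs; rewrite -def_s mem_cat (negPf vs1).
have lt_v : index v s2 < size s - q by rewrite -s2q index_mem.
by rewrite /rot -/s1 -/s2 index_cat vs2 s1q addnC modn_small //; lia.
Qed.

End SeqEdges.

(** * Internally disjoint paths in an arbitrary graph *)

Lemma sum_card_disjoint (I T : finType) (F : {set I}) (D : I -> {set T})
    (U : {set T}) :
    (forall i, i \in F -> D i \subset U) ->
    (forall i j, i \in F -> j \in F -> i != j -> D i :&: D j = set0) ->
  \sum_(i in F) #|D i| <= #|U|.
Proof.
move=> sDU dD.
have -> : \sum_(i in F) #|D i| = \sum_(i in F) \sum_(x in U) (x \in D i).
  apply: eq_bigr => i Fi; rewrite -sum1_card big_mkcond [RHS]big_mkcond /=.
  apply: eq_bigr => x _; case: ifP => [xD | _]; last by case: ifP.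
  by rewrite (subsetP (sDU i Fi)).
(* Exchanging the sums, each point of U is counted at most once. *)
rewrite exchange_big /= -sum1_card; apply: leq_sum => x _.
have [/exists_inP[i Fi xi] | no_i] := boolP [exists i in F, x \in D i].
  rewrite (bigD1 i) //= xi big1 // => j /andP[Fj ne_ji].
  apply/eqP; rewrite eqb0; apply/negP=> xj.
  by have:= dD j i Fj Fi ne_ji; move/setP/(_ x); rewrite !inE xi xj.
rewrite big1 // => i Fi; apply/eqP; rewrite eqb0.
by apply: contra no_i => xi; apply/exists_inP; exists i.
Qed.

Section PathFamilies.

Variable G : sgraph.
Implicit Types (S : {set G}) (F : {set gpath G}).

(** This rule and the next replace membership in a bounded sequence by membership
    in the underlying sequence, to which the lemmas about sequences apply. *)
Lemma mem_pvertices (p : gpath G) x :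
  (x \in pvertices p) = (x \in (val p : seq G)).
Proof. by rewrite inE. Qed.

Lemma mem_pedges (p : gpath G) E : (E \in pedges p) = (E \in seq_edges (val p)).
Proof. by rewrite inE. Qed.

Lemma gpathP (p : seq G) : is_gpath p -> exists q : gpath G, val q = p :> seq G.
Proof.
move=> gp; have up : uniq p by case/and3P: gp.
have le_p : size p <= #|G| by rewrite -(card_uniqP up) max_card.
pose bp : {bseq #|G| of G} := Bseq le_p.
have gbp : is_gpath bp by [].
by exists (exist _ bp gbp).
Qed.

(** Conditions are only required for [i < j], so that a construction may treat
    its first path specially. Since [S] has two vertices, each path has an edge,
    and edge-disjointness makes the [m] paths pairwise different. *)
Lemma pi_set_ge S m (P : nat -> seq G) : 1 < #|S| ->
    (forall i, i < m -> is_gpath (P i) /\ {subset S <= P i}) ->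
    (forall i j, i < j -> j < m -> forall x, x \in P i -> x \in P j -> x \in S) ->
    (forall i j, i < j -> j < m -> forall E,
       E \in seq_edges (P i) -> E \in seq_edges (P j) -> False) ->
  m <= pi_set S.
Proof.
move=> S_gt1 gP vP eP.
have [|g gE] := @fin_all_exists 'I_m (fun=> gpath G)
                   (fun i q => val q = P i :> seq G).
  by move=> i; apply: gpathP; case: (gP i).
have disj i j : i != j -> internally_disjoint S (g i) (g j).
  move=> ne_ij; apply/andP; split; apply/eqP/setP.
    move=> E; rewrite in_setI in_set0 !mem_pedges !gE; apply/negP=> /andP[Ei Ej].
    case: (ltngtP i j) ne_ij => [lt_ij _ | lt_ji _ | /val_inj-> /eqP//].
      exact: (eP i j lt_ij (ltn_ord j) E).
    exact: (eP j i lt_ji (ltn_ord i) E).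
  move=> x; rewrite in_setI !mem_pvertices !gE; apply/andP/idP => [[xi xj] | Sx].
    case: (ltngtP i j) ne_ij => [lt_ij _ | lt_ji _ | /val_inj-> /eqP//].
      exact: (vP i j lt_ij (ltn_ord j) x).
    exact: (vP j i lt_ji (ltn_ord i) x).
  by have [_ /(_ x Sx)] := gP i (ltn_ord i); have [_ /(_ x Sx)] := gP j (ltn_ord j).
have inj_g : injective g.
  move=> i j eq_g; apply/eqP; apply: contraT => /disj /andP[/eqP/setP dE _].
  have [gi Si] := gP i (ltn_ord i).
  have [|E Ei] := @seq_edges_neq0 G (P i).
    apply: leq_trans S_gt1 _; rewrite -(card_uniqP (_ : uniq (P i))).
      by apply: subset_leq_card; apply/subsetP.
    by case/and3P: gi.
  by have:= dE E; rewrite -eq_g in_setI in_set0 mem_pedges gE Ei.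
have -> : m = #|g @: setT| by rewrite card_imset // cardsT card_ord.
apply: leq_bigmax_cond; apply/andP; split; apply/forall_inP=> _ /imsetP[i _ ->].
  by apply/subsetP=> x Sx; rewrite mem_pvertices gE; case: (gP i (ltn_ord i)) => _; apply.
apply/forall_inP=> _ /imsetP[j _ ->]; apply/implyP=> ne_g; apply: disj.
by apply: contra ne_g => /eqP->.
Qed.

Definition inner_edges S : {set {set G}} :=
  [set [set u; v] | u in S, v in S & edge u v].

Lemma card_inner_edges_path S (p : gpath G) : is_Spath S p ->
  #|S| - 1 <= #|pedges p :&: inner_edges S| + #|pvertices p :\: S|.
Proof.
move=> Sp; have /and3P[_ sp up] := valP p.
rewrite leq_subLR addnC.
have -> : #|S| = count (mem S) (val p).
  rewrite -size_filter -(card_uniqP (filter_uniq _ up)).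
  apply: eq_card => x; rewrite mem_filter /=; case: (boolP (x \in S)) => //= Sx.
  by have /subsetP/(_ x Sx) := Sp; rewrite mem_pvertices => ->.
have -> : #|pvertices p :\: S| = count (predC (mem S)) (val p).
  rewrite -size_filter -(card_uniqP (filter_uniq _ up)).
  by apply: eq_card => x; rewrite mem_filter in_setD mem_pvertices.
apply: leq_trans (count_seq_edges S (val p)) _; rewrite !leq_add2r.
rewrite -size_filter -(card_uniqP (filter_uniq _ (seq_edges_uniq up))).
apply: subset_leq_card; apply/subsetP=> E; rewrite mem_filter => /andP[sES pE].
rewrite in_setI mem_pedges pE; apply/imset2P; case: p {Sp} sp {up} pE => -[p _] /= _ sp.
elim: p sp => [|x [|y p] IH] //= /andP[exy sp].
rewrite seq_edges_cons inE => /predU1P[def_E | /(IH sp)//].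
by move: sES; rewrite def_E subUset !sub1set => /andP[Sx Sy];
  exists x y; rewrite // inE Sy exy.
Qed.

(** Summing [card_inner_edges_path] over the family: both the edges inside [S]
    and the vertices outside [S] are used by at most one path. *)
Lemma disjoint_Spaths_edge_bound S F : disjoint_Spaths S F ->
  #|F| * (#|S| - 1) <= #|inner_edges S| + #|~: S|.
Proof.
case/andP=> /forall_inP SF /forall_inP dF.
have dis p q : p \in F -> q \in F -> p != q -> internally_disjoint S p q.
  by move=> Fp Fq ne_pq; have /forall_inP/(_ q Fq)/implyP/(_ ne_pq) := dF p Fp.
rewrite -sum_nat_const.
apply: (@leq_trans (\sum_(p in F)
    (#|pedges p :&: inner_edges S| + #|pvertices p :\: S|))).
  by apply: leq_sum => p /SF; apply: card_inner_edges_path.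
rewrite big_split /=; apply: leq_add; apply: sum_card_disjoint => [p _|p q Fp Fq].
- exact: subsetIr.
- by case/(dis p q Fp Fq)/andP=> /eqP dE _; rewrite setIACA dE set0I.
- by apply/subsetP=> x; rewrite !inE => /andP[].
case/(dis p q Fp Fq)/andP=> _ /eqP dV.
by rewrite !setDE setIACA dV setIid setICr.
Qed.

Lemma kpath_connectivity_ge k m : k <= #|G| ->
  (forall S, #|S| = k -> m <= pi_set S) -> m <= kpath_connectivity G k.
Proof.
by move=> /kpath_connectivityP[[S Sk <-] _] min_m; apply: min_m.
Qed.

End PathFamilies.

(** * Chunks and rotations of lists *)

Lemma disjoint_chunks (T : finType) (U : {set T}) (c : nat -> nat) m :
    \sum_(i < m) c i <= #|U| ->
  exists D : nat -> seq T,
    (forall i, i < m -> [/\ uniq (D i), size (D i) = c i & {subset D i <= U}]) /\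
    (forall i j x, i < j -> j < m -> x \in D i -> x \in D j -> False).
Proof.
elim: m U => [|m IH] U le_cU; first by exists (fun=> [::]); split.
move: le_cU; rewrite big_ord_recr /= => le_cU.
have /card_geqP[s [us sz_s sU]] : c m <= #|U| by lia.
have card_s : #|[set:: s]| = c m by rewrite cardsE (card_uniqP us).
have /IH[D [D1 D2]] : \sum_(i < m) c i <= #|U :\: [set:: s]|.
  have sU' : [set:: s] \subset U by apply/subsetP=> x; rewrite inE; apply: sU.
  rewrite cardsD (setIidPr sU') card_s leq_subRL 1?addnC //.
  exact: leq_trans (leq_addl _ _) le_cU.
exists (fun i => if i == m then s else D i); split=> [i | i j x lt_ij].
  rewrite ltnS leq_eqVlt; case: (eqVneq i m) => [-> _ //| _ /= /D1[? ? sD]].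
  by split=> // x /sD; rewrite inE => /andP[].
rewrite ltnS leq_eqVlt; case: (eqVneq j m) => [def_j _ | _ /= lt_jm].
  rewrite ltn_eqF; last by rewrite -def_j.
  have [_ _ sD] := D1 i (leq_trans lt_ij (eq_leq def_j)).
  by move/sD; rewrite !inE => /andP[/negP].
by rewrite ltn_eqF ?(ltn_trans lt_ij) //; apply: D2.
Qed.

(** By [index_rot] the position of [u] in [t] is [c + 2i + e] and also
    [c + 2j + e'] modulo [size t], with [e, e' <= 1]. As [2i + e] and
    [2j + e'] are smaller than [size t], they are equal, so [i = j]. *)
Lemma rot_index_inj (T : finType) (t : seq T) u i j c :
    uniq t -> u \in t -> i.*2.+1 < size t -> j.*2.+1 < size t ->
    c <= index u (rot i.*2 t) <= c.+1 -> c <= index u (rot j.*2 t) <= c.+1 ->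
  i = j.
Proof.
move=> ut tu lt_i lt_j ci cj.
have [ei [ei1 def_i]] : exists e, e <= 1 /\ index u (rot i.*2 t) = c + e.
  by exists (index u (rot i.*2 t) - c); lia.
have [ej [ej1 def_j]] : exists e, e <= 1 /\ index u (rot j.*2 t) = c + e.
  by exists (index u (rot j.*2 t) - c); lia.
have := index_rot ut (ltnW lt_i) tu; rewrite (index_rot ut (ltnW lt_j) tu).
rewrite def_i def_j -!addnA => /eqP; rewrite eqn_modDl !modn_small; lia.
Qed.

(** * Bounds from above in complete bipartite graphs *)

Section CompleteBipartiteGraph.

Variables a b : nat.
Local Notation K := (Kbip a b).
Implicit Types (S : {set K}) (d : bool).

(** The parts are indexed by a boolean, so that each argument is made once for
    both: [side true] has size [a] and [side false] has size [b]. *)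
Definition side d : {set K} := [set v : K | is_inl v == d].

Lemma card_K : #|K| = a + b.
Proof. by rewrite card_sum !card_ord. Qed.

Lemma card_side d : #|side d| = if d then a else b.
Proof.
have card_im (T : finType) (f : T -> K) : injective f ->
    #|[set f x | x : T]| = #|T| by move=> f_inj; rewrite card_imset // cardsT.
case: d.
  rewrite -[RHS]card_ord -(card_im _ (@inl 'I_a 'I_b)); last by move=> ? ? [].
  apply: eq_card => -[i|i]; rewrite inE /=; apply/esym.
    by apply/imsetP; exists i.
  by apply/imsetP=> -[].
rewrite -[RHS]card_ord -(card_im _ (@inr 'I_a 'I_b)); last by move=> ? ? [].
apply: eq_card => -[i|i]; rewrite inE /=; apply/esym.
  by apply/imsetP=> -[].
by apply/imsetP; exists i.
Qed.

Lemma sideN d : side (~~ d) = ~: side d.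
Proof. by apply/setP=> v; rewrite !inE; case: (is_inl v); case: d. Qed.

Lemma side_notin d u : u \in side d -> u \in side (~~ d) = false.
Proof. by rewrite sideN in_setC => ->. Qed.

Lemma edge_side d u v : u \in side d -> v \in side (~~ d) -> edge u v && edge v u.
Proof.
by rewrite !inE /= /Kbip_edge => /eqP-> /eqP->; case: d.
Qed.

Lemma edgeN d u v : edge u v -> (v \in side d) = (u \notin side d).
Proof.
by rewrite !inE /= /Kbip_edge; case: (is_inl u); case: (is_inl v); case: d.
Qed.

Lemma card_sides d S : #|S| = #|S :&: side d| + #|S :&: side (~~ d)|.
Proof. by rewrite sideN -setDE cardsID. Qed.

Lemma card_inner_edges d S :
  #|inner_edges S| <= #|S :&: side d| * #|S :&: side (~~ d)|.
Proof.
rewrite -cardsX; set X := setX _ _.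
apply: leq_trans (leq_imset_card (fun z : K * K => [set z.1; z.2]) (mem X)).
apply: subset_leq_card; apply/subsetP=> E /imset2P[u v Su Sv ->].
move: Sv; rewrite inE => /andP[Sv euv]; apply/imsetP.
have := edgeN d euv; case: (boolP (u \in side d)) => /= du dv.
  by exists (u, v); rewrite // inE /= !in_setI Su Sv du sideN in_setC dv.
exists (v, u); last by rewrite setUC.
by rewrite inE /= !in_setI Su Sv sideN in_setC du dv.
Qed.

(** The induction proves the sharper inequality without the 1 when the path
    starts outside [side d]. *)
Lemma gpath_balanced d (p : gpath K) :
  #|pvertices p :&: side d| <= #|pvertices p :&: side (~~ d)| + 1.
Proof.
have /and3P[_ sp up] := valP p.
have cnt e : #|pvertices p :&: side e| = count (mem (side e)) (val p).
  rewrite -size_filter -(card_uniqP (filter_uniq _ up)).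
  by apply: eq_card => x; rewrite mem_filter in_setI mem_pvertices andbC.
rewrite !{}cnt; case: p sp {up} => -[p _] /= _ sp.
suff: count (mem (side d)) p <= count (mem (side (~~ d))) p
         + head false [seq x \in side d | x <- p].
  by case: (head _ _) => /=; lia.
elim: p sp => [|x [|y p] IH] //; first by rewrite /= addn0 leq_addl.
rewrite [sorted _ _]/= => /andP[exy /IH].
move: (edgeN d exy); rewrite /= !sideN !in_setC => ->.
by case: (x \in side d) => /=; lia.
Qed.

(** By balance each path has at least [#|S :&: side (~~ d)| - 1] vertices in
    [side d], and those outside [S] belong to no other path. *)
Lemma disjoint_Spaths_side_bound d S F : disjoint_Spaths S F ->
  #|F| * (#|S :&: side (~~ d)| - 1 - #|S :&: side d|) <= #|side d :\: S|.
Proof.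
case/andP=> /forall_inP SF /forall_inP dF; rewrite -sum_nat_const.
apply: (@leq_trans (\sum_(p in F) #|pvertices p :&: side d :\: S|)).
  apply: leq_sum => p /SF Sp; have := gpath_balanced (~~ d) p; rewrite negbK.
  have := subset_leq_card (setSI (side (~~ d)) Sp).
  rewrite cardsD setIAC; have := subset_leq_card (subsetIr (pvertices p) S).
  have -> : pvertices p :&: S = S by apply/setIidPr.
  by lia.
apply: sum_card_disjoint => [p Fp | p q Fp Fq ne_pq].
  by rewrite setSD // subsetIr.
have /forall_inP/(_ q Fq)/implyP/(_ ne_pq)/andP[_ /eqP dV] := dF p Fp.
by rewrite !setDE setIACA setIid setIACA dV setIid setIAC setICr set0I.
Qed.

Lemma set_of_sides x y : x <= a -> y <= b ->
  exists S, #|S :&: side true| = x /\ #|S :&: side false| = y.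
Proof.
move=> le_xa le_yb.
have /card_geqP[s [us sz_s sA]] : x <= #|side true| by rewrite card_side.
have /card_geqP[t [ut sz_t tB]] : y <= #|side false| by rewrite card_side.
have mem_st v : (v \in [set:: s] :|: [set:: t]) = (v \in s) || (v \in t).
  by rewrite !inE.
exists ([set:: s] :|: [set:: t]); split.
  rewrite -sz_s -(card_uniqP us); apply: eq_card => v; rewrite in_setI mem_st.
  apply/andP/idP => [[/orP[//|/tB/side_notin/= ->//]] | sv].
  by rewrite sv sA.
rewrite -sz_t -(card_uniqP ut); apply: eq_card => v; rewrite in_setI mem_st.
apply/andP/idP => [[/orP[/sA/side_notin/= ->//|//]] | tv].
by rewrite tv orbT tB.
Qed.

Lemma card_sideD d S :
  #|side d :\: S| = (if d then a else b) - #|S :&: side d|.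
Proof. by rewrite cardsD card_side setIC. Qed.

Lemma kpath_connectivity_le x y : x <= a -> y <= b ->
  let m := kpath_connectivity K (x + y) in
  m * (y - 1 - x) <= a - x /\
  m * (x + y - 1) <= x * y + (a + b - (x + y)).
Proof.
move=> le_xa le_yb m; have [S [Sx Sy]] := set_of_sides le_xa le_yb.
have cardS : #|S| = x + y by rewrite (card_sides true) Sx Sy.
have le_m : m <= pi_set S.
  by apply: (kpath_connectivityP _).2 => //; rewrite card_K leq_add.
have [F dF le_mF] : exists2 F, disjoint_Spaths S F & m <= #|F|.
  have F0 : disjoint_Spaths S set0.
    by apply/andP; split; apply/forall_inP=> p; rewrite inE.
  have [F dF def_pi] := @eq_bigmax_cond _ (disjoint_Spaths S)
    (fun F : {set gpath K} => #|F|) (ltac:(apply/card_gt0P; by exists set0)).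
  by exists F; rewrite // -def_pi.
have := disjoint_Spaths_side_bound true dF; have := disjoint_Spaths_edge_bound dF.
have := card_inner_edges true S; rewrite Sx Sy cardS.
rewrite card_sideD Sx.
have -> : #|~: S| = a + b - (x + y) by rewrite cardsCs setCK card_K cardS.
move=> le_e le1 le2; split.
  by apply: leq_trans le2; rewrite leq_mul2r le_mF orbT.
apply: leq_trans (leq_trans le1 (leq_add le_e (leqnn _))).
by rewrite leq_mul2r le_mF orbT.
Qed.

(** * Families of zigzags *)

Lemma zigzag_gpath d (s t : seq K) :
    {subset s <= side d} -> {subset t <= side (~~ d)} -> uniq s -> uniq t ->
    size t <= size s <= (size t).+1 -> 0 < size s ->
  is_gpath (zigzag s t).
Proof.
move=> sd td us ut sz_st s_gt0; have perm_st := perm_zigzag sz_st.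
apply/and3P; split.
- by rewrite -size_eq0 (perm_size perm_st) size_cat -lt0n addn_gt0 s_gt0.
- exact: (sorted_zigzag (@edge_side d)).
rewrite (perm_uniq perm_st) cat_uniq us ut andbT; apply/hasPn=> v /td.
by rewrite sideN in_setC; apply: contra => /sd.
Qed.

(** An edge has one end on each side, so a common edge has the same ends in both
    zigzags and obeys both position constraints. *)
Lemma zigzag_common_edge d (s t s' t' : seq K) E :
    {subset s <= side d} -> {subset t <= side (~~ d)} ->
    {subset s' <= side d} -> {subset t' <= side (~~ d)} ->
    uniq s -> uniq t -> uniq s' -> uniq t' ->
    E \in seq_edges (zigzag s t) -> E \in seq_edges (zigzag s' t') ->
  exists u v, [/\ u \in s /\ u \in s', v \in t /\ v \in t',
    index v t <= index u s <= (index v t).+1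
    & index v t' <= index u s' <= (index v t').+1].
Proof.
move=> sd td sd' td' us ut us' ut' /zigzag_edge-/(_ us ut)[u [v [-> su tv uv]]].
case/zigzag_edge=> // u' [v' [eqE su' tv' uv']].
have du := sd _ su; have du' := sd' _ su'; have dv := td _ tv; have dv' := td' _ tv'.
have eq_u : u = u'.
  have : u \in [set u'; v'] by rewrite -eqE set21.
  rewrite in_set2 => /orP[/eqP// | /eqP eq_uv'].
  by move: (side_notin du); rewrite eq_uv' dv'.
have eq_v : v = v'.
  have : v \in [set u'; v'] by rewrite -eqE set22.
  rewrite in_set2 => /orP[/eqP eq_vu' | /eqP//].
  by move: (side_notin du'); rewrite -eq_vu' dv.
by subst u' v'; exists u, v.
Qed.

Lemma enum_setI_sub d S : {subset enum (S :&: side d) <= side d}.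
Proof. by move=> v; rewrite mem_enum in_setI => /andP[]. Qed.

(** The path [j] interleaves [side d] rotated by [2j] with the part of [S] on the
    other side. No vertex outside [S] is used. *)
Lemma pi_set_rotations d S n : 1 < #|S| -> #|side d| = n -> side d \subset S ->
    #|S :&: side (~~ d)| <= n -> n <= #|S :&: side (~~ d)|.+1 ->
  n./2 <= pi_set S.
Proof.
move=> S_gt1 <- dS le_tn le_nt; have {le_tn le_nt} := conj le_tn le_nt.
move/andP; set s := enum (side d); set t := enum (S :&: side (~~ d)).
have sz_s : size s = #|side d| by rewrite -cardE.
have sz_t : size t = #|S :&: side (~~ d)| by rewrite -cardE.
rewrite -sz_s -sz_t => sz_st.
have sd q : {subset rot q s <= side d} by move=> v; rewrite mem_rot mem_enum.
have td : {subset t <= side (~~ d)} by apply: enum_setI_sub.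
have us : uniq s := enum_uniq _; have ut : uniq t := enum_uniq _.
have sz_q q : size t <= size (rot q s) <= (size t).+1 by rewrite size_rot.
have mem_zz q v : (v \in zigzag (rot q s) t) = (v \in S).
  rewrite (perm_mem (perm_zigzag (sz_q q))) mem_cat mem_rot !mem_enum.
  rewrite sideN !inE; have := subsetP dS v; rewrite !inE.
  by case: (_ == d) => [->|_]; rewrite ?andbT.
apply: (@pi_set_ge _ S _ (fun i => zigzag (rot i.*2 s) t)) => //.
- move=> i lt_i; split; last by move=> v; rewrite mem_zz.
  by apply: (zigzag_gpath (d := d)); rewrite ?rot_uniq ?size_rot //; lia.
- by move=> i j _ _ v; rewrite mem_zz.
move=> i j lt_ij lt_j E /zigzag_common_edge EP /EP-/(_ d).
case; rewrite ?rot_uniq // => u [v [[su _] [tv _] uv uv']].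
rewrite mem_rot in su.
have := rot_index_inj us su _ _ uv uv'; lia.
Qed.

(** The part of [S] in [side false] is enlarged to [minn a.+1 b] vertices, which
    is [a] or [a + 1], and then interleaved with all of [side true]. *)
Lemma pi_set_ge1 S : a <= b -> 1 < #|S| -> #|S :&: side false| <= a.+1 ->
  1 <= pi_set S.
Proof.
move=> le_ab S_gt1 le_Sa; set t := enum (side true); set s := enum (S :&: side false).
have sz_t : size t = a by rewrite -cardE card_side.
have sz_s : size s = #|S :&: side false| by rewrite -cardE.
have : minn a.+1 b - size s <= #|side false :\: S|.
  by rewrite card_sideD -sz_s; lia.
case/card_geqP=> r [ur sz_r rP].
have := subset_leq_card (subsetIr S (side false)); rewrite -sz_s card_side => le_sb.
have gsr : is_gpath (zigzag (s ++ r) t).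
  apply: (zigzag_gpath (d := false)); rewrite ?enum_uniq //.
  - move=> v; rewrite mem_cat mem_enum in_setI => /orP[/andP[]// | /rP].
    by rewrite in_setD => /andP[].
  - by move=> v; rewrite mem_enum.
  - rewrite cat_uniq ur enum_uniq andbT; apply/hasPn=> v /rP.
    by rewrite mem_enum in_setD in_setI => /andP[/negPf->].
  - by rewrite size_cat; lia.
  rewrite size_cat; case: (posnP a) => [a0|]; last by lia.
  have := card_sides true S; have := subset_leq_card (subsetIr S (side true)).
  rewrite card_side [in X in _ <= X]a0 leqn0 => /eqP-> /= cardS.
  by rewrite addn_gt0 sz_s -[X in 0 < X]add0n -cardS (ltnW S_gt1).
apply: (@pi_set_ge _ S _ (fun=> zigzag (s ++ r) t)) => //;
  try by move=> i j lt_ij; rewrite ltnS leqn0 => /eqP j0; rewrite j0 in lt_ij.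
move=> i _; split=> // v Sv.
rewrite (perm_mem (perm_zigzag _)) ?size_cat; last by lia.
rewrite !mem_cat !mem_enum in_setI Sv; have := sideN true => /= ->.
by rewrite in_setC orbAC; case: (v \in side true).
Qed.

(** If [S] lies on one side, each path uses [#|S| - 1] private vertices of the
    other side to link the vertices of [S].

    Otherwise let [X], [Y] be the parts of [S], of sizes [x], [y], and let the
    path [i] interleave [X ++ D i] with [D' i ++ Y], where the [D i] and [D' i]
    are disjoint lists outside [S] of sizes [y] and [x]. The positions of [X] in
    the first list are those of [D' i] in the second, so no edge joins [X] to
    [Y]. These sizes would need [m * y <= a - x] and [m * x <= b - y], which can
    fail by one. So the lists of the path 0 are one
    item shorter; this creates a single edge inside [S], which is harmless as
    the other paths have none. *)
Lemma pi_set_chunks S m : 1 < #|S| ->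
  m * (#|S| - 1) <= a -> a <= b -> m <= pi_set S.
Proof.
move=> S_gt1 le_ma le_ab; case: (posnP m) => [->//|m_gt0].
have le_m d : m * (#|S| - 1) <= #|side d|.
  by rewrite card_side; case: d; rewrite ?(leq_trans le_ma).
have [[d Sd0] | S_sides] : (exists d, S :&: side d = set0) \/
                           (forall d, 0 < #|S :&: side d|).
  case: (set_0Vmem (S :&: side true)) => [|[u Su]]; first by left; exists true.
  case: (set_0Vmem (S :&: side false)) => [|[v Sv]]; first by left; exists false.
  by right=> -[]; apply/card_gt0P; [exists u | exists v].
  have [|D [DP D_disj]] := @disjoint_chunks _ (side d) (fun=> #|S| - 1) m.
    by rewrite sum_nat_const card_ord.
  have sSd : {subset enum S <= side (~~ d)}.
    move=> v; rewrite mem_enum sideN in_setC => Sv; apply/negP=> dv.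
    by have := in_set0 v; rewrite -Sd0 in_setI Sv dv.
  have sz i : i < m -> size (D i) <= size (enum S) <= (size (D i)).+1.
    by case/DP=> _ -> _; rewrite -cardE; lia.
  apply: (@pi_set_ge _ S _ (fun i => zigzag (enum S) (D i))) => //.
  - move=> i lt_i; have [uD sz_D sD] := DP i lt_i; split.
      apply: (zigzag_gpath (d := ~~ d)); rewrite ?negbK ?enum_uniq ?sz //.
      by rewrite -cardE (ltnW S_gt1).
    by move=> v Sv; rewrite (perm_mem (perm_zigzag (sz i lt_i))) mem_cat mem_enum Sv.
  - move=> i j lt_ij lt_j v; have lt_i := ltn_trans lt_ij lt_j.
    rewrite (perm_mem (perm_zigzag (sz i lt_i))) (perm_mem (perm_zigzag (sz j lt_j))).
    rewrite !mem_cat !mem_enum; case: (v \in S) => //=.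
    by move=> iv jv; case: (D_disj i j v).
  move=> i j lt_ij lt_j E; have [ui _ si] := DP i (ltn_trans lt_ij lt_j).
  have [uj _ sj] := DP j lt_j; move/zigzag_common_edge => EP /EP-/(_ (~~ d)).
  rewrite negbK enum_uniq; case=> // u [v [_ [iv jv] _ _]].
  exact: (D_disj i j v).
set x := #|S :&: side true|; set y := #|S :&: side false|.
have [x_gt0 y_gt0] : 0 < x /\ 0 < y by split; apply: S_sides.
have cardS : #|S| = x + y := card_sides true S.
(* This is the total size needed on a side: the path 0 saves one vertex. *)
have sum_c n : n > 0 -> \sum_(i < m) (n - (i == 0 :> nat)) = m * n - 1.
  case: (m) m_gt0 => // m' _ n_gt0; rewrite big_ord_recl /=.
  rewrite (eq_bigr (fun=> n)) => [|i _]; last by rewrite subn0.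
  by rewrite sum_nat_const card_ord; lia.
have [|D [DP D_disj]] :=
    @disjoint_chunks _ (side true :\: S) (fun i => y - (i == 0)) m.
  rewrite sum_c // card_sideD -/x.
  have := le_m true; rewrite cardS card_side.
  nia.
have [|D' [DP' D'_disj]] :=
    @disjoint_chunks _ (side false :\: S) (fun i => x - (i == 0)) m.
  rewrite sum_c // card_sideD -/y.
  have := le_m false; rewrite cardS card_side.
  nia.
set X := enum (S :&: side true); set Y := enum (S :&: side false).
have sz_X : size X = x by rewrite -cardE.
have sz_Y : size Y = y by rewrite -cardE.
have XP v : (v \in X) = (v \in S) && (v \in side true) by rewrite mem_enum in_setI.
have YP v : (v \in Y) = (v \in S) && (v \in side false) by rewrite mem_enum in_setI.
have DS i v : i < m -> v \in D i -> v \notin S /\ v \in side true.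
  by case/DP=> _ _ sD /sD; rewrite in_setD => /andP[].
have DS' i v : i < m -> v \in D' i -> v \notin S /\ v \in side false.
  by case/DP'=> _ _ sD /sD; rewrite in_setD => /andP[].
have sX i : i < m -> {subset X ++ D i <= side true}.
  by move=> lt_i v; rewrite mem_cat XP => /orP[/andP[] // | /(DS i v lt_i)[]].
have sY i : i < m -> {subset D' i ++ Y <= side false}.
  by move=> lt_i v; rewrite mem_cat YP => /orP[/(DS' i v lt_i)[] | /andP[]].
have uX i : i < m -> uniq (X ++ D i).
  move=> lt_i; have [uD _ _] := DP i lt_i; rewrite cat_uniq uD enum_uniq andbT.
  by apply/hasPn=> v /(DS i v lt_i)[Sv _]; rewrite XP (negPf Sv).
have uY i : i < m -> uniq (D' i ++ Y).
  move=> lt_i; have [uD _ _] := DP' i lt_i; rewrite cat_uniq uD enum_uniq andbT.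
  by apply/hasPn=> v; rewrite YP => /andP[Sv _]; apply/negP=> /(DS' i v lt_i)[/negP].
have sz i : i < m -> size (X ++ D i) = x + y - (i == 0) /\
                     size (D' i ++ Y) = x + y - (i == 0).
  move=> lt_i; have [_ sD _] := DP i lt_i; have [_ sD' _] := DP' i lt_i.
  by rewrite !size_cat sz_X sz_Y sD sD'; case: (i == 0); lia.
have sz2 i : i < m -> size (D' i ++ Y) <= size (X ++ D i) <= (size (D' i ++ Y)).+1.
  by move=> lt_i; have [-> ->] := sz i lt_i; rewrite leqnn leqnSn.
apply: (@pi_set_ge _ S _ (fun i => zigzag (X ++ D i) (D' i ++ Y))) => //.
- move=> i lt_i; split.
    apply: (zigzag_gpath (d := true)); rewrite ?uX ?uY ?sz2 //; first exact: sX.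
      exact: sY.
    by have [-> _] := sz i lt_i; case: (i == 0); lia.
  move=> v Sv; rewrite (perm_mem (perm_zigzag (sz2 i lt_i))) !mem_cat XP YP Sv.
  have := sideN true => /= ->; rewrite in_setC.
  by case: (v \in side true); rewrite ?orbT.
- move=> i j lt_ij lt_j v; have lt_i := ltn_trans lt_ij lt_j.
  rewrite (perm_mem (perm_zigzag (sz2 i lt_i))) (perm_mem (perm_zigzag (sz2 j lt_j))).
  rewrite !mem_cat XP YP; case: (boolP (v \in S)) => //= _; rewrite !orbF.
  case/orP=> [iv | iv] /orP[jv | jv].
  + by case: (D_disj i j v).
  + have [_ /side_notin/=] := DS i v lt_i iv.
    by have [_ ->] := DS' j v lt_j jv.
  + have [_ /side_notin/=] := DS j v lt_j jv.
    by have [_ ->] := DS' i v lt_i iv.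
  + by case: (D'_disj i j v).
move=> i j lt_ij lt_j E; have lt_i := ltn_trans lt_ij lt_j.
move/zigzag_common_edge => EP
  /EP-/(_ true (sX i lt_i) (sY i lt_i) (sX j lt_j) (sY j lt_j)).
case; rewrite ?uX ?uY // => u [v [[iu ju] [iv jv] _]].
(* The ends of a common edge lie in S: u in X, at a position below x in the
   first list, and v in Y, hence at a position at least x in the second list
   because D' j has exactly x items for j > 0. This contradicts zigzag_edge. *)
have Xu : u \in X.
  move: iu ju; rewrite !mem_cat; case: (u \in X) => //=.
  by move=> iu ju; case: (D_disj i j u).
have Yv : v \notin D' j.
  move: iv jv; rewrite !mem_cat YP; case: (boolP (v \in S)) => [Sv _ _ | _] /=.
    by apply/negP=> /(DS' j v lt_j)[/negP].
  by rewrite !orbF => iv jv; case: (D'_disj i j v).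
rewrite !index_cat Xu (negPf Yv).
have [_ -> _] := DP' j lt_j; have := index_mem u X; rewrite Xu sz_X.
by case: j lt_ij {lt_j ju jv Yv} => // j _ /=; lia.
Qed.

Lemma pi_set_ge2 S (P0 P1 : seq K) : 1 < #|S| ->
    is_gpath P0 -> is_gpath P1 -> {subset S <= P0} -> {subset S <= P1} ->
    (forall v, v \in P0 -> v \in P1 -> v \in S) ->
    (forall E, E \in seq_edges P0 -> E \in seq_edges P1 -> False) ->
  2 <= pi_set S.
Proof.
move=> S_gt1 gP0 gP1 SP0 SP1 vP eP.
apply: (@pi_set_ge _ S _ (fun i => if i is 0 then P0 else P1)) => //.
- by case.
- by case=> [|i] [|[|j]].
by case=> [|i] [|[|j]].
Qed.

(** Both paths run through all of [side d] and the rest [r] of [S]; the path 0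
    uses [v] and the path 1 uses [w], the two vertices missed by [S]. As [v] and
    [w] occupy the same position in front of [r], the vertices of [r] have equal
    positions in [v :: r] and [w :: r], and the rotation by 2 separates the
    edges. *)
Lemma pi_set_ge2_full_side d S : 4 <= #|side d| -> side d \subset S ->
    #|side (~~ d)| = #|side d| -> #|side (~~ d) :\: S| = 2 ->
  2 <= pi_set S.
Proof.
move=> d_ge4 dS eq_d /eqP/cards2P[v [w [ne_vw vwE]]].
set s := enum (side d); set r := enum (S :&: side (~~ d)).
have sz_s : size s = #|side d| by rewrite -cardE.
have s_ge4 : 4 <= size s by rewrite sz_s.
have sz_r : size r = size s - 2.
  have := cardsID S (side (~~ d)).
  by rewrite vwE cards2 ne_vw setIC eq_d sz_s /r -cardE => <-; rewrite addnK.
have us : uniq s := enum_uniq _; have ur : uniq r := enum_uniq _.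
have rP u : (u \in r) = (u \in S) && (u \in side (~~ d)) by rewrite mem_enum in_setI.
have vwP u : u \in [set v; w] -> (u \notin S) /\ u \in side (~~ d).
  by rewrite -vwE in_setD => /andP[].
have xr u : u \in [set v; w] -> {subset u :: r <= side (~~ d)} /\ uniq (u :: r).
  move=> /vwP[Su du]; split; last by rewrite cons_uniq rP (negPf Su) ur.
  by move=> z; rewrite in_cons rP => /predU1P[->//|/andP[]].
have [vd uv] := xr v (set21 v w); have [wd uw] := xr w (set22 v w).
have [vS _] := vwP v (set21 v w); have [wS _] := vwP w (set22 v w).
have sd q : {subset rot q s <= side d} by move=> u; rewrite mem_rot mem_enum.
have sz q u : size (u :: r) <= size (rot q s) <= (size (u :: r)).+1.
  rewrite size_rot /= sz_r; case: (size s) s_ge4 => [|[|n]] // _.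
  by rewrite subn2 leqnSn leqnn.
have memP q u z : (z \in zigzag (rot q s) (u :: r)) = (z \in S) || (z == u).
  rewrite (perm_mem (perm_zigzag (sz q u))) mem_cat in_cons mem_rot mem_enum rP.
  rewrite [in RHS](_ : z \in S = (z \in side d) || (z \in S) && (z \in side (~~ d))).
    by rewrite -orbA [X in _ = _ || X]orbC.
  have := subsetP dS z; rewrite sideN in_setC.
  by case: (z \in side d) => [->//|_]; rewrite andbT.
have gP q u : u \in [set v; w] -> is_gpath (zigzag (rot q s) (u :: r)).
  move=> /xr[ud uu]; apply: (zigzag_gpath (d := d)); rewrite ?rot_uniq //.
  by rewrite size_rot (ltn_trans _ s_ge4).
apply: (@pi_set_ge2 S (zigzag (rot 0.*2 s) (v :: r)) (zigzag (rot 1.*2 s) (w :: r))).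
- by apply: leq_trans (subset_leq_card dS); apply: ltn_trans d_ge4.
- by apply: gP; rewrite set21.
- by apply: gP; rewrite set22.
- by move=> z Sz; rewrite memP Sz.
- by move=> z Sz; rewrite memP Sz.
- move=> z; rewrite !memP; case: (z \in S) => //= /eqP->.
  by rewrite (negPf ne_vw).
move=> E /zigzag_common_edge EP /EP-/(_ d (sd _) vd (sd _) wd).
case; rewrite ?rot_uniq // => x [y [[sx _] [vy wy] xy xy']].
rewrite mem_rot in sx.
have [ne_vy ne_wy] : v != y /\ w != y.
  split; apply: contraTneq ne_vw => eq_y.
    by move: wy; rewrite -eq_y in_cons rP (negPf vS) orbF => ->.
  by move: vy; rewrite -eq_y in_cons rP (negPf wS) orbF eq_sym => ->.
rewrite [index y _]/= (negPf ne_vy) in xy.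
rewrite [index y _]/= (negPf ne_wy) in xy'.
suff: 0 = 1 by [].
apply: (@rot_index_inj _ s x 0 1 (index y r).+1) => //.
exact: ltn_trans s_ge4.
Qed.

(** Let [S] miss [v] and [w], one on each side. The path 0 lives inside [S], the
    path 1 is Hamiltonian with [v] and [w] put in front of the lists. This shifts
    all positions of [S] by one on both sides, so the edges of the path 0
    keep the position differences of the unrotated zigzag. *)
Lemma pi_set_ge2_balanced S : 4 <= a -> a = b ->
    #|S :&: side true| = a - 1 -> #|S :&: side false| = a - 1 ->
  2 <= pi_set S.
Proof.
move=> a_ge4 eq_ab St Sf.
have dS d : #|side d :\: S| = 1.
  by rewrite card_sideD; case: d; rewrite ?St ?Sf -?eq_ab; lia.
have /eqP/cards1P[v vE] := dS true; have /eqP/cards1P[w wE] := dS false.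
have : v \in side true :\: S by rewrite vE set11.
have : w \in side false :\: S by rewrite wE set11.
rewrite !in_setD => /andP[Sw dw] /andP[Sv dv].
set r := enum (S :&: side true); set r' := enum (S :&: side false).
have sz_r : size r = a - 1 by rewrite -cardE.
have sz_r' : size r' = a - 1 by rewrite -cardE.
have rP u : (u \in r) = (u \in S) && (u \in side true) by rewrite mem_enum in_setI.
have rP' u : (u \in r') = (u \in S) && (u \in side false) by rewrite mem_enum in_setI.
have ur : uniq r := enum_uniq _; have ur' : uniq r' := enum_uniq _.
have uv : uniq (v :: r) by rewrite cons_uniq rP (negPf Sv) ur.
have uw : uniq (w :: r') by rewrite cons_uniq rP' (negPf Sw) ur'.
have rd : {subset r <= side true} by apply: enum_setI_sub.
have rd' : {subset r' <= side (~~ true)} by apply: enum_setI_sub.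
have vd : {subset rot 1.*2 (v :: r) <= side true}.
  by move=> u; rewrite mem_rot in_cons => /predU1P[-> // | /rd].
have wd : {subset w :: r' <= side (~~ true)}.
  by move=> u; rewrite in_cons => /predU1P[-> // | /rd'].
have sz0 : size r' <= size r <= (size r').+1 by rewrite sz_r sz_r' leqnn leqnSn.
have sz1 : size (w :: r') <= size (rot 1.*2 (v :: r)) <= (size (w :: r')).+1.
  by rewrite size_rot /= sz_r sz_r' leqnn leqnSn.
have memr u : (u \in r ++ r') = (u \in S).
  rewrite mem_cat rP rP'; have := sideN true => /= ->; rewrite in_setC.
  by case: (u \in side true); rewrite ?andbT ?andbF ?orbF.
apply: (@pi_set_ge2 S (zigzag r r') (zigzag (rot 1.*2 (v :: r)) (w :: r'))).
- by rewrite (card_sides true) St; lia.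
- by apply: (zigzag_gpath (d := true)); rewrite // sz_r; lia.
- by apply: (zigzag_gpath (d := true)); rewrite // ?rot_uniq // size_rot.
- by move=> u Su; rewrite (perm_mem (perm_zigzag sz0)) memr.
- move=> u; rewrite (perm_mem (perm_zigzag sz1)) mem_cat mem_rot !in_cons -memr.
  by rewrite mem_cat => /orP[->|->]; rewrite !orbT.
- by move=> u; rewrite (perm_mem (perm_zigzag sz0)) memr.
move=> E /zigzag_common_edge EP /EP-/(_ true rd rd' vd wd).
case; rewrite ?rot_uniq // => x [y [[rx vx] [ry _] xy xy']].
rewrite mem_rot in vx.
have ne_vx : v != x by apply: contraTneq rx => <-; rewrite rP (negPf Sv).
have ne_wy : w != y by apply: contraTneq ry => <-; rewrite rP' (negPf Sw).
have xy0 : index y (w :: r') <= index x (rot 0.*2 (v :: r)) <= (index y (w :: r')).+1.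
  by rewrite rot0 /= (negPf ne_vx) (negPf ne_wy).
have vr_ge4 : 4 <= size (v :: r) by rewrite /= sz_r subn1 prednK // ltnW // ltnW // ltnW.
suff: 0 = 1 by [].
apply: (@rot_index_inj _ (v :: r) x 0 1 (index y (w :: r'))) => //.
exact: ltn_trans vr_ge4.
Qed.

End CompleteBipartiteGraph.

(** * The values of the path-connectivity *)

Theorem theorem1p1 (a b k : nat) (ha : 1 <= a) (hab : a <= b)
    (hk : 2 <= k) (hkn : k <= a + b) :
  (k <= a -> kpath_connectivity (Kbip a b) k = a %/ (k - 1)) /\
  (a + 1 <= k ->
    (a = b ->
      ((a = 3 /\ k = 4) \/ (4 <= a /\ a + 1 <= k <= 2 * a - 3) ->
        kpath_connectivity (Kbip a b) k = 1) /\
      (4 <= a /\ k = 2 * a - 2 ->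
        kpath_connectivity (Kbip a b) k = 2) /\
      ((2 <= a /\ k = 2 * a - 1) \/ k = 2 * a ->
        kpath_connectivity (Kbip a b) k = maxn (a %/ 2) 1)) /\
    (b = a + 1 ->
      (a + 1 <= k <= 2 * a ->
        kpath_connectivity (Kbip a b) k = 1) /\
      (k = 2 * a + 1 ->
        kpath_connectivity (Kbip a b) k = (a + 1) %/ 2)) /\
    (a + 2 <= b ->
      (k = a + 1 ->
        kpath_connectivity (Kbip a b) k = 1) /\
      (a + 2 <= k <= a + b ->
        kpath_connectivity (Kbip a b) k = 0))).
Proof.
set m := kpath_connectivity _ _.
have lower n : (forall S : {set Kbip a b}, #|S| = k -> n <= pi_set S) -> n <= m.
  by apply: kpath_connectivity_ge; rewrite card_K.
(* Below, y is always as large as possible: sets with the most vertices in the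
   larger side attain the minimum. *)
have upper x y : x <= a -> y <= b -> x + y = k ->
    m * (y - 1 - x) <= a - x /\ m * (k - 1) <= x * y + (a + b - k).
  by move=> xa yb def_k; have := kpath_connectivity_le xa yb; rewrite def_k.
have sides (S : {set Kbip a b}) : #|S| = k ->
    [/\ #|S :&: side a b true| + #|S :&: side a b false| = k,
        #|S :&: side a b true| <= a & #|S :&: side a b false| <= b].
  move=> Sk; split.
      by rewrite -Sk; have := card_sides true S => /= ->.
    by rewrite -[X in _ <= X](card_side a b true) subset_leq_card ?subsetIr.
  by rewrite -[X in _ <= X](card_side a b false) subset_leq_card ?subsetIr.
have m_ge1 : b <= a + 1 \/ k <= a + 1 -> 1 <= m.
  move=> small; apply: lower => S Sk; have [sumk xa yb] := sides S Sk.
  by apply: pi_set_ge1; rewrite // ?Sk //; case: small => ?; lia.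
have full d (S : {set Kbip a b}) :
    #|S :&: side a b d| = (if d then a else b) -> side a b d \subset S.
  move=> eq_d; apply/setIidPr/eqP.
  by rewrite eqEcard subsetIr card_side eq_d leqnn.
split=> [le_ka | le_ak].
  apply/eqP; rewrite eqn_leq; apply/andP; split; last first.
    apply: lower => S Sk; apply: pi_set_chunks; rewrite ?Sk //.
    exact: leq_divM.
  rewrite leq_divRL; last by lia.
  by have [|||] := upper 0 k; rewrite ?subn0; lia.
split=> [eq_ab | ]; last split=> [eq_b | lt_b].
- split; last split.
  + move=> small; apply/eqP; rewrite eqn_leq m_ge1 ?andbT; last by left; lia.
    have [|||le1 le2] := upper (k - a) a; try lia.
    case: small => [[a3 k4] | [a4 k_range]].
      by subst a b k; lia.
    rewrite leqNgt; apply/negP=> m2.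
    have : 2 * (a - 1 - (k - a)) <= a - (k - a).
      by apply: leq_trans le1; rewrite leq_mul2r m2 orbT.
    by lia.
  + move=> [a4 def_k]; apply/eqP; rewrite eqn_leq; apply/andP; split.
      by have [|||] := upper (a - 2) a; lia.
    apply: lower => S Sk; have [sumk xa yb] := sides S Sk.
    have [x_a | [y_a | [x_a1 y_a1]]] :
        #|S :&: side a b true| = a \/ #|S :&: side a b false| = a \/
        #|S :&: side a b true| = a - 1 /\ #|S :&: side a b false| = a - 1 by lia.
    * apply: (@pi_set_ge2_full_side _ _ true); rewrite ?full ?card_sideD ?card_side //=.
      have -> : #|S :&: side a b false| = a - 2 by lia.
      by lia.
    * apply: (@pi_set_ge2_full_side _ _ false);
        rewrite ?full ?card_sideD ?card_side //= -?eq_ab //.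
        by rewrite y_a.
      have -> : #|S :&: side a b true| = a - 2 by lia.
      by lia.
    * exact: pi_set_ge2_balanced.
  + move=> k_range; rewrite divn2; apply/eqP; rewrite eqn_leq; apply/andP; split.
      have [|||_] := upper (k - a) a; try lia.
      by case: k_range => [[a2 def_k] | def_k]; rewrite def_k; nia.
    rewrite geq_max m_ge1 ?andbT; last by left; lia.
    apply: lower => S Sk; have [sumk xa yb] := sides S Sk.
    have [x_a | y_a] :
        #|S :&: side a b true| = a \/ #|S :&: side a b false| = a by lia.
    * have y_lo : a <= #|S :&: side a b false|.+1 by lia.
      have y_hi : #|S :&: side a b false| <= a by lia.
      by apply: (@pi_set_rotations _ _ true); rewrite ?Sk ?card_side ?full.
    * have x_lo : a <= #|S :&: side a b true|.+1 by lia.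
      by apply: (@pi_set_rotations _ _ false); rewrite ?Sk ?card_side ?full ?y_a.
- split=> [k_range | def_k].
    apply/eqP; rewrite eqn_leq m_ge1 ?andbT; last by left; lia.
    have [|||le1 _] := upper (k - (a + 1)) (a + 1); try lia.
    rewrite -(@leq_pmul2r (a - (k - (a + 1)))) ?mul1n; last by lia.
    by apply: leq_trans le1; rewrite leq_mul2l; lia.
  rewrite divn2; apply/eqP; rewrite eqn_leq; apply/andP; split.
    have [|||_] := upper a (a + 1); try lia.
    by rewrite def_k; nia.
  apply: lower => S Sk; have [sumk xa yb] := sides S Sk.
  have y_b : #|S :&: side a b false| = b by lia.
  have x_lo : a + 1 <= #|S :&: side a b true|.+1 by lia.
  have x_hi : #|S :&: side a b true| <= a + 1 by lia.
  by apply: (@pi_set_rotations _ _ false); rewrite ?Sk ?card_side ?full.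
split=> [def_k | k_range].
  apply/eqP; rewrite eqn_leq m_ge1 ?andbT; last by right; lia.
  have [|||le1 _] := upper 0 (a + 1); try lia.
  rewrite -(@leq_pmul2r a) ?mul1n //.
  by apply: leq_trans (leq_trans le1 (leq_subr _ _)); rewrite leq_mul2l; lia.
(* With minn k b >= a + 2 vertices of S in the larger side, a single path would
   need more vertices of the smaller side than there are. *)
have [|||le1 _] := upper (k - minn k b) (minn k b); try lia.
apply/eqP; rewrite -leqn0 leqNgt; apply/negP=> m_gt0.
have : minn k b - 1 - (k - minn k b) <= a - (k - minn k b).
  by apply: leq_trans le1; rewrite leq_pmull.
by lia.
Qed.
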